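(* Let $\mathbb{P}^4\subset\mathbb{P}^5$ be the hyperplane $x_0+x_1+x_2+x_3+x_4+x_5=0$, where $x_0,\ldots,x_5$ are homogeneous coordinates on $\mathbb{P}^5$ over $\mathbb{C}$. For $t\in\mathbb{C}$ let $X_t\subset\mathbb{P}^4$ be the quartic threefold given by $$x_0^4+x_1^4+x_2^4+x_3^4+x_4^4+x_5^4=t\Big(x_0^2+x_1^2+x_2^2+x_3^2+x_4^2+x_5^2\Big)^2.$$ Then the quartic threefolds $X_{\frac{1}{6}}$ and $X_{\frac{7}{10}}$ are rational. *)

(* Defs.v *)
From HB Require Import structures.
From mathcomp Require Import all_boot all_order all_algebra.
From mathcomp Require Import Rstruct.
From mathcomp Require Import complex.
From mathcomp Require Import mpoly.

Set Implicit Arguments.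
Unset Strict Implicit.
Unset Printing Implicit Defensive.

Import Order.TTheory GRing.Theory Num.Theory.
Local Open Scope ring_scope.

Definition CC : Type := complex Rdefinitions.R.
Definition CC_numClosed : numClosedFieldType := CC.

Definition coneX (t : CC) (x : 'I_6 -> CC) : Prop :=
  \sum_(i < 6) x i = 0 /\
  \sum_(i < 6) x i ^+ 4 = t * (\sum_(i < 6) x i ^+ 2) ^+ 2.

(** X_t is rational: there is a birational map P^3 --> X_t, given by
    homogeneous polynomials F_0..F_5 of a common degree d in 4 variables
    such that
    - F maps (the cone of) P^3 into (the cone of) X_t,
    - the image of F is Zariski dense in X_t (every form vanishing on the
      image vanishes on X_t; in particular X_t is irreducible),
    - F has a rational inverse on its image: homogeneous G_0..G_3 of a common
      degree e in 6 variables with G(F(y)) = h(y) * y for a nonzero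
      polynomial h. *)
Definition rational_X (t : CC) : Prop :=
  exists (d e : nat) (F : 'I_6 -> {mpoly CC[4]}) (G : 'I_4 -> {mpoly CC[6]})
         (h : {mpoly CC[4]}),
    (forall i, F i \is d.-homog) /\
    (forall j, G j \is e.-homog) /\
    h != 0 /\
    (forall y : 'I_4 -> CC, coneX t (fun i => (F i).@[y])) /\
    (forall (y : 'I_4 -> CC) (j : 'I_4),
        (G j).@[fun i => (F i).@[y]] = h.@[y] * y j) /\
    (forall p : {mpoly CC[6]},
        (forall y : 'I_4 -> CC, p.@[fun i => (F i).@[y]] = 0) ->
        forall x : 'I_6 -> CC, coneX t x -> p.@[x] = 0).

(* Main.v *)
(** Both quartics have an equation of the shape [N M + K L = 0] with quadrics [N], [K], [L],
    [M], so they are swept out by the surfaces [N = l K, l M = - L], intersections of two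
    quadrics in the 4-space.  In both cases every such surface contains a line, depending
    rationally on [l].  A plane through this line meets the surface in one further point, and
    the pairs ([l], plane through the line) form a rational threefold: this is the
    parametrization, and its inverse is given by [l = N / K] together with the projection
    from the line.

    For t = 7/10 the determinantal equation expresses that, for any of the six total systems
    of five synthemes on the coordinates, with [q_i] the quadrics attached to the synthemes,
    the quartic is [5 (sum q_i^2) = (sum q_i)^2]; the lines are one ruling of a quadric
    surface in the hyperplane x_0 + x_1 + x_2 = 0.

    The image of the parametrization contains the part of the cone where a polynomial [k]
    does not vanish, and a polynomial vanishing there vanishes on the whole cone as soon as
    some line of the hyperplane meets the cone only in points with [k <> 0]. *)
From Stdlib Require Import ZArith.
Require Import Defs.
From HB Require Import structures.
From mathcomp Require Import all_boot all_order all_algebra.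
From mathcomp Require Import boolp Rstruct complex mpoly ring ssrZ.
Import GRing.Theory Num.Theory.
Local Open Scope ring_scope.

Set Implicit Arguments.
Unset Strict Implicit.
Unset Printing Implicit Defensive.

(** * Density from one fibre *)

Section Density.
Variable C : closedFieldType.

(** Each linear factor is charged to its own copy of [q], so repetitions in [s] are harmless. *)
Lemma prod_XsubC_dvdp_exp (s : seq C) (q : {poly C}) :
  all (root q) s -> \prod_(z <- s) ('X - z%:P) %| q ^+ size s.
Proof.
elim: s => [|z s IHs] /=; first by rewrite big_nil dvd1p.
by case/andP=> qz qs; rewrite big_cons exprS dvdp_mul ?IHs // dvdp_XsubCl.
Qed.

Let ev (T : C) : {poly {poly C}} -> {poly C} := map_poly (horner_eval T).

Let evE T q S : (ev T q).[S] = q.[S%:P].[T].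
Proof.
by rewrite /ev -[S in LHS](hornerC S T) -/(horner_eval T _) horner_map.
Qed.

(* The exceptional values of T are the zeros of the resultant of f and k;
   elsewhere f divides a power of p on the fibre, so the remainder of that power
   modulo f vanishes identically in T. *)
Lemma vanishing_of_generic_fibre (f k p : {poly {poly C}}) :
    f \is monic -> (1 < size f)%N ->
    (forall T S, f.[S%:P].[T] = 0 -> k.[S%:P].[T] != 0 -> p.[S%:P].[T] = 0) ->
    (forall S, f.[S%:P].[1] = 0 -> k.[S%:P].[1] != 0) ->
  forall S, f.[S%:P].[0] = 0 -> p.[S%:P].[0] = 0.
Proof.
move=> mon_f f_gt1 kp k1.
(* Adding this multiple of [f] makes [k] monic without changing it where [f] vanishes; the resultant
   of two monic polynomials commutes with specializing [T]. *)
pose k' := k + f * 'X^(size k).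
have fX_gt : (size k < size (f * 'X^(size k))%R)%N.
  rewrite size_Mmonic ?monicXn ?monic_neq0 // size_polyXn.
  by case: (size f) f_gt1 => [|[|m]] //= _; rewrite addnS /= ltnS leq_addl.
have mon_k' : k' \is monic.
  by rewrite monicE lead_coefDr // lead_coef_Mmonic ?monicXn // (monicP mon_f).
have k'_gt1 : (1 < size k')%N.
  rewrite /k' addrC size_polyDl // size_Mmonic ?monicXn ?monic_neq0 // size_polyXn.
  by rewrite addnS /= (leq_trans f_gt1) ?leq_addr.
have ev_mon T q : q \is monic -> ev T q \is monic by exact: monic_map.
have k'E T S : f.[S%:P].[T] = 0 -> k'.[S%:P].[T] = k.[S%:P].[T].
  by move=> f0; rewrite /k' hornerD hornerM hornerD hornerM f0 mul0r addr0.
have [[a b] /= _ RE] := resultant_in_ideal f_gt1 k'_gt1.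
set R := resultant f k' in RE.
(* At [T = 1] a zero resultant would yield a common root of the specialized [f] and [k'], against
   [k1]. *)
have R1 : R != 0.
  apply: contraTneq isT => R0.
  have: horner_eval 1 R = 0 by rewrite R0 rmorph0.
  rewrite map_resultant -?/(ev 1 _) ?(monicP mon_f) ?(monicP mon_k') ?rmorph1 ?oner_eq0 //.
  move/eqP; rewrite resultant_eq0 => g_gt1.
  have /closed_rootP[z] : size (gcdp (ev 1 f) (ev 1 k')) != 1%N by case: (size _) g_gt1 => [|[]].
  rewrite root_gcd => /andP[/rootP fz /rootP k'z].
  rewrite evE in fz; rewrite evE (k'E _ _ fz) in k'z.
  by have := k1 _ fz; rewrite k'z eqxx.
pose n := (size f).-1.
pose r := Pdiv.Ring.rmodp (p ^+ n) f.
have r0 : r = 0.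
  apply/eqP; apply: contraT => nz_r.
  (* At such a [T] the specialized [f] divides the specialized [r], which has kept its degree; that
     degree is too small. *)
  have /closed_nonrootP[T] : R * lead_coef r != 0 by rewrite mulf_neq0 ?lead_coef_eq0.
  rewrite rootM negb_or => /andP[RT rT].
  have pE : ev T p ^+ n = ev T (Pdiv.Ring.rdivp (p ^+ n) f) * ev T f + ev T r.
    by rewrite /ev -rmorphXn -rmorphM -rmorphD -Pdiv.RingMonic.rdivp_eq.
  have [s fE] := closed_field_poly_normal (ev T f).
  rewrite (monicP (ev_mon T f mon_f)) scale1r in fE.
  have sz_s : size s = n.
    rewrite /n -(size_map_poly_id0 (f := horner_eval T)) -/(ev T f) ?fE ?size_prod_XsubC //.
    by rewrite (monicP mon_f) rmorph1 oner_eq0.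
  have fp : ev T f %| ev T p ^+ n.
    rewrite fE -sz_s; apply: prod_XsubC_dvdp_exp; apply/allP => z zs.
    have fz : f.[z%:P].[T] = 0 by rewrite -evE fE; apply/rootP; rewrite root_prod_XsubC.
    rewrite /root evE kp // -k'E //; apply: contra RT => /eqP k'0.
    rewrite /root -(hornerC R z%:P) RE hornerD !hornerM.
    by rewrite hornerD !hornerM fz k'0 !mulr0 addr0.
  have fr : ev T f %| ev T r by rewrite pE dvdp_addr ?dvdp_mull in fp.
  have szr : size (ev T r) = size r by apply: size_map_poly_id0.
  have := dvdp_leq _ fr; rewrite -size_poly_gt0 szr size_poly_gt0 => /(_ nz_r).
  rewrite leqNgt => /negP[].
  rewrite size_map_poly_id0; last by rewrite (monicP mon_f) rmorph1 oner_eq0.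
  by apply: Pdiv.Ring.ltn_rmodpN0 => //; exact: monic_neq0.
move=> S fS; have := Pdiv.RingMonic.rdivp_eq mon_f (p ^+ n); rewrite -/r r0 addr0.
move/(congr1 (fun q => q.[S%:P].[0])); rewrite hornerM hornerM fS mulr0 !horner_exp.
by move/eqP; rewrite expf_eq0 => /andP[_ /eqP].
Qed.
End Density.

(** * Evaluation of forms and restriction to a plane *)

Lemma rmorph_mmap (n : nat) (R S T : comNzRingType) (g : {rmorphism R -> S})
    (phi : {rmorphism S -> T}) (h : 'I_n -> S) (p : {mpoly R[n]}) :
  phi (mmap g h p) = mmap (phi \o g) (phi \o h) p.
Proof.
rewrite /mmap raddf_sum; apply: eq_bigr => m _ /=; rewrite rmorphM /mmap1 rmorph_prod /=.
by congr (_ * _); apply: eq_bigr => i _; rewrite rmorphXn.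
Qed.

Lemma meval_dhomog (n d : nat) (R : comNzRingType) (p : {mpoly R[n]}) (c : R) (y : 'I_n -> R) :
  p \is d.-homog -> p.@[fun i => c * y i] = c ^+ d * p.@[y].
Proof.
move=> /dhomogP hp; rewrite !mevalE big_distrr /=; apply: eq_big_seq => m /hp <-.
rewrite mulrCA; congr (_ * _); rewrite /= mdegE -prodrXr -big_split /=.
by apply: eq_bigr => i _; rewrite exprMn.
Qed.

Section Plane.
Variables (C : comNzRingType) (n : nat) (x b v : 'I_n -> C).

(** The plane through [x] and the line [b + S v], with [S] as outer and [T] as inner variable:
    [T = 0] is the parallel line through [x], and [T = 1] the line through [b]. *)
Definition plane_coord i : {poly {poly C}} :=
  ((x i)%:P + (b i - x i) *: 'X)%:P + (v i)%:P%:P * 'X.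

Definition plane_pol (q : {mpoly C[n]}) : {poly {poly C}} :=
  mmap (polyC \o polyC) plane_coord q.

Lemma plane_polE q T S :
  (plane_pol q).[S%:P].[T] = q.@[fun i => x i + T * (b i - x i) + S * v i].
Proof.
rewrite -[LHS]/((horner_eval T \o horner_eval S%:P) (plane_pol q)).
rewrite /plane_pol rmorph_mmap /mmap mevalE; apply: eq_bigr => m _ /=.
rewrite /horner_eval !hornerC; congr (_ * _).
rewrite /mmap1; apply: eq_bigr => i _; congr (_ ^+ _).
rewrite /= /horner_eval !(hornerD, hornerC, hornerM, hornerX, hornerZ).
by rewrite mulrC [S * _]mulrC [T * _]mulrC.
Qed.
End Plane.

(** * The quartic form and its restriction to a plane *)

Section Quartic.
Variables (C : comNzRingType) (n : nat) (t : C).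

Definition quartic_form : {mpoly C[n]} :=
  \sum_(i < n) 'X_i ^+ 4 - t *: (\sum_(i < n) 'X_i ^+ 2) ^+ 2.

Lemma quartic_formE x :
  quartic_form.@[x] = \sum_(i < n) x i ^+ 4 - t * (\sum_(i < n) x i ^+ 2) ^+ 2.
Proof.
rewrite /quartic_form mevalB mevalZ rmorphXn /= !raddf_sum /=.
by congr (_ - _ * _ ^+ 2); apply: eq_bigr => i _; rewrite rmorphXn /= mevalXU.
Qed.

Lemma quartic_form_homog : quartic_form \is 4.-homog.
Proof.
have X1 i : ('X_i : {mpoly C[n]}) \is 1.-homog by rewrite dhomogX; apply/eqP/mdeg1.
have sum_homog k : \sum_(i < n) ('X_i : {mpoly C[n]}) ^+ k \is k.-homog.
  by apply: rpred_sum => i _; have := dhomogMn k (X1 i); rewrite mul1n.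
by rewrite rpredB ?rpredZ //; exact: (dhomogMn 2 (sum_homog 2)).
Qed.

Let psum (S : comNzRingType) (a w : 'I_n -> S) j k := \sum_(i < n) a i ^+ j * w i ^+ k.

Let psum_expr (S : comNzRingType) (a w : 'I_n -> S) X :
  (\sum_(i < n) (a i + w i * X) ^+ 2 =
     psum a w 2 0 + 2%:R * psum a w 1 1 * X + psum a w 0 2 * X ^+ 2) *
  (\sum_(i < n) (a i + w i * X) ^+ 4 =
     psum a w 4 0 + 4%:R * psum a w 3 1 * X + 6%:R * psum a w 2 2 * X ^+ 2
     + 4%:R * psum a w 1 3 * X ^+ 3 + psum a w 0 4 * X ^+ 4).
Proof.
by split; rewrite /psum !mulr_sumr !mulr_suml -!big_split /=; apply: eq_bigr => i _; ring.
Qed.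

(** The coefficient of degree 4 is the value of the quartic at [v], constant in [T]; normalizing it
    to 1 makes the restriction monic, as [vanishing_of_generic_fibre] requires. *)
Lemma plane_pol_quartic (x b v : 'I_n -> C) : quartic_form.@[v] = 1 ->
  exists2 r, plane_pol x b v quartic_form = 'X^4 + r & (size r <= 4)%N.
Proof.
move=> v1.
pose a i : {poly C} := (x i)%:P + (b i - x i) *: 'X.
pose w i : {poly C} := (v i)%:P; pose tt : {poly C} := t%:P; pose s := psum a w.
pose c0 := s 4 0 - tt * s 2 0 ^+ 2.
pose c1 := 4%:R * s 3 1 - tt * (4%:R * s 2 0 * s 1 1).
pose c2 := 6%:R * s 2 2 - tt * (2%:R * s 2 0 * s 0 2 + 4%:R * s 1 1 ^+ 2).
pose c3 := 4%:R * s 1 3 - tt * (4%:R * s 1 1 * s 0 2).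
exists (Poly [:: c0; c1; c2; c3]); last exact: size_Poly.
have c4 : s 0 4 - tt * s 0 2 ^+ 2 = 1.
  rewrite -(rmorph1 polyC) -v1 quartic_formE rmorphB rmorphM rmorphXn /= !raddf_sum /=.
  by congr (_ - _ * _ ^+ 2); apply: eq_bigr => i _; rewrite mul1r rmorphXn.
have sC j k : psum (fun i => (a i)%:P) (fun i => (w i)%:P) j k = (s j k)%:P.
  by rewrite /s /psum rmorph_sum; apply: eq_bigr => i _; rewrite rmorphM !rmorphXn.
rewrite -['X^4]mul1r -(rmorph1 polyC) -c4 /= !cons_poly_def.
rewrite /plane_pol /quartic_form raddfB /= mmapZ rmorphXn !raddf_sum /=.
under eq_bigr do rewrite rmorphXn /= mmapX mmap1U.
under [X in _ - _ * X ^+ 2]eq_bigr do rewrite rmorphXn /= mmapX mmap1U.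
rewrite !psum_expr !sC -/tt /c0 /c1 /c2 /c3.
move: (s) (tt) => {v1 c0 c1 c2 c3 c4 sC a w} {}s {}tt.
rewrite !(rmorphD, rmorphN, rmorphM, rmorphXn, rmorph0, rmorph_nat).
ring.
Qed.
End Quartic.

(** * Density of the image from one good line *)

Section Criterion.
Variables (C : closedFieldType) (t : C).

(** This is [coneX] over any algebraically closed field, convertible to it over [CC_numClosed]. *)
Definition cone (x : 'I_6 -> C) : Prop :=
  \sum_(i < 6) x i = 0 /\
  \sum_(i < 6) x i ^+ 4 = t * (\sum_(i < 6) x i ^+ 2) ^+ 2.

Lemma coneE x : cone x <-> \sum_(i < 6) x i = 0 /\ (quartic_form 6 t).@[x] = 0.
Proof.
rewrite quartic_formE; split=> -[x0 xq]; split=> //; first by rewrite xq subrr.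
by apply/eqP; rewrite -subr_eq0 xq.
Qed.

Variables (d : nat) (F : 'I_6 -> {mpoly C[4]}) (k : {mpoly C[6]}).
Hypotheses (d_gt0 : (0 < d)%N) (F_homog : forall i, F i \is d.-homog).
Hypothesis F_onto : forall x, cone x -> k.@[x] != 0 ->
  exists y c, c != 0 /\ forall i, (F i).@[y] = c * x i.
Variables b v : 'I_6 -> C.
Hypotheses (b0 : \sum_(i < 6) b i = 0) (v0 : \sum_(i < 6) v i = 0).
Hypothesis v1 : (quartic_form 6 t).@[v] != 0.
Hypothesis fibre : forall S, (quartic_form 6 t).@[fun i => b i + S * v i] = 0 ->
  k.@[fun i => b i + S * v i] != 0.

Lemma closed_root (n : nat) (c : C) : (0 < n)%N -> exists a, a ^+ n = c.
Proof.
move=> n_gt0; have /closed_rootP[a] : size ('X^n - c%:P) != 1%N.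
  by rewrite size_XnsubC // eqSS -lt0n.
by rewrite /root !hornerE subr_eq0 => /eqP; exists a.
Qed.

(** By homogeneity of positive degree [d], a [d]-th root absorbs the scalar left by [F_onto]. *)
Lemma F_surj x : cone x -> k.@[x] != 0 -> exists y, forall i, (F i).@[y] = x i.
Proof.
move=> xX kx; have [y [c [c0 Fy]]] := F_onto xX kx.
have [a aE] := closed_root c^-1 d_gt0.
by exists (fun i => a * y i) => i; rewrite (meval_dhomog _ _ (F_homog i)) Fy aE mulKf.
Qed.

(** The density lemma is applied in the plane through [x] and the test line [b + S v]; [x] itself is
    the point [T = S = 0]. *)
Lemma vanishing_on_image (p : {mpoly C[6]}) :
    (forall y, p.@[fun i => (F i).@[y]] = 0) ->
  forall x, cone x -> p.@[x] = 0.
Proof.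
move=> pF x /coneE[x0 xq].
have [a aE] := closed_root ((quartic_form 6 t).@[v])^-1 (isT : 0 < 4)%N.
pose v' i := a * v i.
have v'1 : (quartic_form 6 t).@[v'] = 1.
  by rewrite (meval_dhomog _ _ (quartic_form_homog 6 t)) aE mulVf.
have [r fE szr] := plane_pol_quartic x b v'1.
pose pl := plane_pol x b v'.
have mon_f : pl (quartic_form 6 t) \is monic.
  by rewrite /pl fE monicE lead_coefDl ?lead_coefXn // size_polyXn ltnS.
have f_gt1 : (1 < size (pl (quartic_form 6 t)))%N.
  by rewrite /pl fE size_polyDl size_polyXn // ltnS.
have := @vanishing_of_generic_fibre C _ (pl k) (pl p) mon_f f_gt1 _ _ 0.
rewrite !plane_polE.
have E q' : q'.@[fun i => x i + 0 * (b i - x i) + 0 * v' i] = q'.@[x].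
  by apply: meval_eq => i /=; rewrite !mul0r !addr0.
rewrite !E; apply=> [T S|S|]; last exact: xq; rewrite !plane_polE.
- move=> fTS kTS; have [|y Fy] := F_surj _ kTS; last first.
    by rewrite -(pF y); apply: meval_eq => i; rewrite Fy.
  apply/coneE; split=> //.
  by rewrite !big_split /= -!mulr_sumr big_split /= sumrN b0 x0 v0 subrr !mulr0 !addr0.
- have E1 q' : q'.@[fun i => x i + 1 * (b i - x i) + S * v' i]
      = q'.@[fun i => b i + (S * a) * v i].
    by apply: meval_eq => i /=; rewrite mul1r [x i + _]addrC subrK mulrA.
  by rewrite !E1; apply: fibre.
Qed.
End Criterion.

(** * Pencils of quartic del Pezzo surfaces containing a line *)

Record vec5 (R : Type) := Vec5 { z0 : R; z1 : R; z2 : R; f1 : R; f2 : R }.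
Record vec4 (R : Type) := Vec4 { y0 : R; y1 : R; y2 : R; y3 : R }.

Definition map5 R S (g : R -> S) (z : vec5 R) :=
  Vec5 (g (z0 z)) (g (z1 z)) (g (z2 z)) (g (f1 z)) (g (f2 z)).
Definition map4 R S (g : R -> S) (y : vec4 R) :=
  Vec4 (g (y0 y)) (g (y1 y)) (g (y2 y)) (g (y3 y)).

Lemma map5E R S (g : R -> S) x0 x1 x2 x3 x4 :
  map5 g (Vec5 x0 x1 x2 x3 x4) = Vec5 (g x0) (g x1) (g x2) (g x3) (g x4).
Proof. by []. Qed.

Definition fun4 R (y : vec4 R) (j : 'I_4) : R := nth (y0 y) [:: y0 y; y1 y; y2 y; y3 y] j.

Section Pencil.
Variable R : comNzRingType.
Implicit Types (Q : vec5 R -> R) (x z : vec5 R) (y : vec4 R).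

Definition comb5 a x b x' c x'' := Vec5
  (a * z0 x + b * z0 x' + c * z0 x'') (a * z1 x + b * z1 x' + c * z1 x'')
  (a * z2 x + b * z2 x' + c * z2 x'') (a * f1 x + b * f1 x' + c * f1 x'')
  (a * f2 x + b * f2 x' + c * f2 x'').

Definition polar Q x x' := Q (comb5 1 x 1 x' 0 x') - Q x - Q x'.

(** Expansion on three points is what restricting a quadric to the plane of [base], [dir1] and
    [dir2] uses. *)
Definition quadratic Q := forall a x b x' c x'', Q (comb5 a x b x' c x'') =
  a ^+ 2 * Q x + b ^+ 2 * Q x' + c ^+ 2 * Q x''
  + a * b * polar Q x x' + a * c * polar Q x x'' + b * c * polar Q x' x''.

Lemma quadraticZ Q a x : quadratic Q -> Q (map5 ( *%R a) x) = a ^+ 2 * Q x.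
Proof.
move=> qQ; have := qQ a x 0 x 0 x; rewrite !(mulr0, mul0r, expr0n, addr0) /= => <-.
by congr Q; case: x => *; rewrite /comb5 /map5 /= !mul0r !addr0.
Qed.

Variables (th et : R) (N K L M : vec5 R -> R).

(* The surface [N = l K], [l M = - L] for [l = y3 / y0]. *)
Definition Phi y x := y0 y * N x - y3 y * K x.
Definition Psi y x := y0 y * L x + y3 y * M x.

(* With [l = y3 / y0], the line in the surface is spanned by [dir1] and [dir2] (cleared of
   denominators), and [base] is the point with [f1 = f2 = 0] for which the plane it spans with
   the line has the parameters [(y0 : y1 : y2)]. *)
Definition base y := Vec5 (y0 y ^+ 2) (y0 y * y1 y) (y0 y * y2 y - th * y3 y * y1 y) 0 0.
Definition dir1 y := Vec5 0 (y0 y * y3 y) (- th * y3 y ^+ 2) (y0 y ^+ 2) 0.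
Definition dir2 y := Vec5 0 0 (et * y0 y * y3 y) 0 (y0 y ^+ 2).

(* Restricted to the plane, each of the two quadrics is the line plus a residual line;
   [(tau : alpha : beta)] is the intersection of the two residual lines. *)
Definition tau y := polar (Phi y) (base y) (dir1 y) * polar (Psi y) (base y) (dir2 y)
                  - polar (Phi y) (base y) (dir2 y) * polar (Psi y) (base y) (dir1 y).
Definition alpha y := polar (Phi y) (base y) (dir2 y) * Psi y (base y)
                    - Phi y (base y) * polar (Psi y) (base y) (dir2 y).
Definition beta y := Phi y (base y) * polar (Psi y) (base y) (dir1 y)
                   - polar (Phi y) (base y) (dir1 y) * Psi y (base y).

Definition param y := comb5 (tau y) (base y) (alpha y) (dir1 y) (beta y) (dir2 y).

(** Here [y3 / y0 = N / K], while [y1] and [y2] are solved from the condition that [z] lie in the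
    plane of [base], [dir1], [dir2]; [comb_proj] records the resulting decomposition. *)
Definition proj z := Vec4 (K z * z0 z) (K z * z1 z - N z * f1 z)
  (K z * z2 z + th * N z * z1 z - et * N z * f2 z) (N z * z0 z).

Definition isotropic_line Q x x' := [/\ Q x = 0, Q x' = 0 & polar Q x x' = 0].

Hypotheses (qN : quadratic N) (qK : quadratic K) (qL : quadratic L) (qM : quadratic M).
Hypothesis line_Phi : forall y, isotropic_line (Phi y) (dir1 y) (dir2 y).
Hypothesis line_Psi : forall y, isotropic_line (Psi y) (dir1 y) (dir2 y).

Lemma quadratic_Phi y : quadratic (Phi y).
Proof. by move=> a x b x' c x''; rewrite /polar /Phi !qN !qK /polar; ring. Qed.

Lemma quadratic_Psi y : quadratic (Psi y).
Proof. by move=> a x b x' c x''; rewrite /polar /Psi !qL !qM /polar; ring. Qed.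

(** The factor [a] cuts out the line, the other factor the residual line. *)
Lemma isotropic_comb Q x x' x'' a b c : quadratic Q -> isotropic_line Q x' x'' ->
  Q (comb5 a x b x' c x'') = a * (a * Q x + b * polar Q x x' + c * polar Q x x'').
Proof. by move=> qQ [Qx' Qx'' Qx]; rewrite qQ Qx' Qx'' Qx; ring. Qed.

(** [(tau, alpha, beta)] is the cross product of the coefficient vectors of the two residual lines,
    hence orthogonal to both. *)
Lemma Phi_param y : Phi y (param y) = 0.
Proof.
by rewrite isotropic_comb //; [rewrite /alpha /beta /tau; ring | exact: quadratic_Phi].
Qed.

Lemma Psi_param y : Psi y (param y) = 0.
Proof.
by rewrite isotropic_comb //; [rewrite /alpha /beta /tau; ring | exact: quadratic_Psi].
Qed.

(** Since [y0 N = y3 K] at the parametrized point, the [alpha] and [beta] terms cancel. *)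
Lemma proj_param y :
  proj (param y) = map4 ( *%R (K (param y) * tau y * y0 y)) y.
Proof.
have := Phi_param y; rewrite /Phi => /eqP; rewrite subr_eq0 => /eqP E.
rewrite /proj /map4; move: (K _) (N _) E => k n E.
by congr Vec4; rewrite /param /=; ring: E.
Qed.

Lemma projZ a z : proj (map5 ( *%R a) z) = map4 ( *%R (a ^+ 3)) (proj z).
Proof. by rewrite /proj /map4 /= !quadraticZ //; congr Vec4; ring. Qed.

Lemma comb_proj z : map5 ( *%R (K z ^+ 2 * z0 z ^+ 2)) z =
  comb5 (z0 z) (base (proj z)) (f1 z) (dir1 (proj z)) (f2 z) (dir2 (proj z)).
Proof. by rewrite /map5 /comb5; congr Vec5 => /=; ring. Qed.

End Pencil.

Section PencilDomain.
Variable R : idomainType.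
Variables (th et : R) (N K L M : vec5 R -> R).
Hypotheses (qN : quadratic N) (qK : quadratic K) (qL : quadratic L) (qM : quadratic M).
Hypothesis line_Phi : forall y, isotropic_line (Phi N K y) (dir1 th y) (dir2 et y).
Hypothesis line_Psi : forall y, isotropic_line (Psi L M y) (dir1 th y) (dir2 et y).

Local Notation param := (param th et N K L M).
Local Notation tau := (tau th et N K L M).
Local Notation proj := (proj th et N K).

(** Eliminating [y0] and [y3] from [y0 N = y3 K] and [y0 L = - y3 M] gives the equation, multiplied
    by the square of either one. If both are zero, so is [param y]. *)
Lemma param_on y : N (param y) * M (param y) + K (param y) * L (param y) = 0.
Proof.
have /eqP : Phi N K y (param y) = 0 by exact: Phi_param.
rewrite subr_eq0 => /eqP PhiE.
have /eqP : Psi L M y (param y) = 0 by exact: Psi_param.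
rewrite addr_eq0 => /eqP PsiE.
have [y00|y0_nz] := eqVneq (y0 y) 0; last first.
  apply: (mulfI (expf_neq0 2 y0_nz)).
  move: (N _) (M _) (K _) (L _) PhiE PsiE => n m k l PhiE PsiE.
  transitivity (y0 y * n * (y0 y * m) + y0 y * k * (y0 y * l)); first by ring.
  by rewrite PhiE PsiE; ring.
have [y30|y3_nz] := eqVneq (y3 y) 0; last first.
  apply: (mulfI (expf_neq0 2 y3_nz)).
  move: (N _) (M _) (K _) (L _) PhiE PsiE => n m k l PhiE PsiE.
  transitivity (y3 y * n * (y3 y * m) + y3 y * k * (y3 y * l)); first by ring.
  have -> : y3 y * m = - (y0 y * l) by rewrite PsiE opprK.
  by rewrite -PhiE; ring.
have -> : param y = comb5 0 (base th y) 0 (base th y) 0 (base th y).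
  by rewrite /param /comb5 /alpha /beta /tau /polar /Phi /Psi y00 y30 !(mul0r, subr0, addr0, mulr0).
by rewrite qN qK !expr0n /= !mul0r !addr0 !mul0r addr0.
Qed.

(** The point [z] lies on the surface of its own parameter, so [(z0 : f1 : f2)] satisfies the
    equations of both residual lines and is proportional to [(tau : alpha : beta)]. *)
Lemma param_proj z : N z * M z + K z * L z = 0 -> z0 z != 0 ->
  param (proj z) = map5 ( *%R (K z ^+ 2 * z0 z * tau (proj z))) z.
Proof.
move=> zX z_nz; set y := proj z.
have PhiE : Phi N K y (map5 ( *%R (K z ^+ 2 * z0 z ^+ 2)) z) = 0.
  by rewrite /Phi !quadraticZ // /y /=; ring.
have PsiE : Psi L M y (map5 ( *%R (K z ^+ 2 * z0 z ^+ 2)) z) = 0.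
  rewrite /Psi !quadraticZ // /y /=.
  by rewrite -[RHS](mulr0 ((K z ^+ 2 * z0 z ^+ 2) ^+ 2 * z0 z)) -zX; ring.
have cE := comb_proj th et N K z.
rewrite cE isotropic_comb // in PhiE; last exact: quadratic_Phi.
rewrite cE isotropic_comb // in PsiE; last exact: quadratic_Psi.
rewrite -/y in cE PhiE PsiE.
move/eqP: PhiE; rewrite mulf_eq0 (negPf z_nz) => /eqP PhiE.
move/eqP: PsiE; rewrite mulf_eq0 (negPf z_nz) => /eqP PsiE.
have {}PhiE : z0 z * Phi N K y (base th y) = - (f1 z * polar (Phi N K y) (base th y) (dir1 th y)
    + f2 z * polar (Phi N K y) (base th y) (dir2 et y)).
  by apply/eqP; rewrite -addr_eq0 addrA PhiE.
have {}PsiE : z0 z * Psi L M y (base th y) = - (f1 z * polar (Psi L M y) (base th y) (dir1 th y)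
    + f2 z * polar (Psi L M y) (base th y) (dir2 et y)).
  by apply/eqP; rewrite -addr_eq0 addrA PsiE.
have aE : z0 z * alpha th et N K L M y = tau y * f1 z.
  by rewrite /alpha mulrBr mulrCA PsiE mulrA PhiE /tau; ring.
have bE : z0 z * beta th N K L M y = tau y * f2 z.
  by rewrite /beta mulrBr mulrA PhiE mulrCA PsiE /tau; ring.
have E : map5 ( *%R (z0 z)) (param y) = map5 ( *%R (tau y)) (map5 ( *%R (K z ^+ 2 * z0 z ^+ 2)) z).
  rewrite cE /param; move: (alpha _ _ _ _ _ _ _) (beta _ _ _ _ _ _) (tau _) aE bE.
  move: (base _ _) (dir1 _ _) (dir2 _ _) => n u v a b t aE bE; rewrite /map5 /comb5.
  by congr Vec5 => /=; rewrite !mulrDr !mulrA aE bE; ring.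
case: (param y) E => p0 p1 p2 p3 p4 [E0 E1 E2 E3 E4].
by congr Vec5; apply: (mulfI z_nz); rewrite ?E0 ?E1 ?E2 ?E3 ?E4; ring.
Qed.
End PencilDomain.

(** * Base change and homogeneity of the parametrization *)

Section Naturality.
Variables (R S : comNzRingType) (g : {rmorphism R -> S}).
Variables (th et : R) (N K L M : vec5 R -> R) (th' et' : S) (N' K' L' M' : vec5 S -> S).
Hypotheses (gth : g th = th') (get : g et = et').
Hypotheses (gN : forall z, g (N z) = N' (map5 g z)) (gK : forall z, g (K z) = K' (map5 g z)).
Hypotheses (gL : forall z, g (L z) = L' (map5 g z)) (gM : forall z, g (M z) = M' (map5 g z)).

Let mapE := (rmorphD, rmorphB, rmorphN, rmorphM, rmorphXn, rmorph0, rmorph1).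

Lemma map5_comb5 a x b x' c x'' : map5 g (comb5 a x b x' c x'') =
  comb5 (g a) (map5 g x) (g b) (map5 g x') (g c) (map5 g x'').
Proof. by rewrite /map5 /comb5 /= !mapE. Qed.

Lemma map_polar Q Q' x x' : (forall z, g (Q z) = Q' (map5 g z)) ->
  g (polar Q x x') = polar Q' (map5 g x) (map5 g x').
Proof. by move=> gQ; rewrite /polar !mapE !gQ map5_comb5 !mapE. Qed.

Lemma map_Phi y z : g (Phi N K y z) = Phi N' K' (map4 g y) (map5 g z).
Proof. by rewrite /Phi !mapE gN gK. Qed.

Lemma map_Psi y z : g (Psi L M y z) = Psi L' M' (map4 g y) (map5 g z).
Proof. by rewrite /Psi !mapE gL gM. Qed.

Lemma map5_base y : map5 g (base th y) = base th' (map4 g y).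
Proof. by rewrite /map5 /base /= !mapE gth. Qed.

Lemma map5_dir1 y : map5 g (dir1 th y) = dir1 th' (map4 g y).
Proof. by rewrite /map5 /dir1 /= !mapE gth. Qed.

Lemma map5_dir2 y : map5 g (dir2 et y) = dir2 et' (map4 g y).
Proof. by rewrite /map5 /dir2 /= !mapE get. Qed.

Let map_polar_Phi y x x' := map_polar x x' (map_Phi y).
Let map_polar_Psi y x x' := map_polar x x' (map_Psi y).
Let polE := (map_polar_Phi, map_polar_Psi, map_Phi, map_Psi,
  map5_base, map5_dir1, map5_dir2).

Lemma map_tau y : g (tau th et N K L M y) = tau th' et' N' K' L' M' (map4 g y).
Proof. by rewrite /tau rmorphB !rmorphM !polE. Qed.

Lemma map5_param y : map5 g (param th et N K L M y) = param th' et' N' K' L' M' (map4 g y).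
Proof.
by rewrite /param map5_comb5 map_tau /alpha /beta 2!rmorphB !rmorphM !polE.
Qed.

Lemma map4_proj z : map4 g (proj th et N K z) = proj th' et' N' K' (map5 g z).
Proof. by rewrite /map4 /proj /= !mapE gN gK gth get. Qed.
End Naturality.

Section Homogeneity.
Variables (C : comNzRingType) (n : nat).
Implicit Types (p q : {mpoly C[n]}).

(** The degree is left as a separate equation, so that [prove_homog] can infer [d1] and [d2]
    first. *)
Lemma homogM d1 d2 d p q :
  p \is d1.-homog -> q \is d2.-homog -> (d1 + d2)%N = d -> p * q \is d.-homog.
Proof. by move=> hp hq <-; apply: dhomogM. Qed.

Lemma homogD d p q : p \is d.-homog -> q \is d.-homog -> p + q \is d.-homog.
Proof. exact: rpredD. Qed.

Lemma homogN d p : p \is d.-homog -> - p \is d.-homog.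
Proof. by rewrite rpredN. Qed.

Lemma homogX d1 d p k : p \is d1.-homog -> (d1 * k)%N = d -> p ^+ k \is d.-homog.
Proof. by move=> hp <-; apply: dhomogMn. Qed.

Lemma homogC c : (c%:MP : {mpoly C[n]}) \is 0.-homog.
Proof. by rewrite -[_%:MP]mulr1 mul_mpolyC dhomogZ ?dhomog1. Qed.

Lemma homogXU i : ('X_i : {mpoly C[n]}) \is 1.-homog.
Proof. by rewrite dhomogX; apply/eqP/mdeg1. Qed.

Lemma homog_nat m : (m%:R : {mpoly C[n]}) \is 0.-homog.
Proof. by rewrite -mpolyC_nat homogC. Qed.

Definition homog5 d (z : vec5 {mpoly C[n]}) :=
  [/\ z0 z \is d.-homog, z1 z \is d.-homog, z2 z \is d.-homog,
      f1 z \is d.-homog & f2 z \is d.-homog].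
Definition homog4 d (y : vec4 {mpoly C[n]}) :=
  [/\ y0 y \is d.-homog, y1 y \is d.-homog, y2 y \is d.-homog & y3 y \is d.-homog].
End Homogeneity.

Ltac prove_degree := first [reflexivity | by rewrite muln2 addnn].

Ltac prove_homog :=
  match goal with
  | |- is_true (0 \is _) => exact: dhomog0
  | |- is_true (1 \is _) => exact: dhomog1
  | |- is_true (_%:R \is _) => exact: homog_nat
  | |- is_true (_%:MP \is _) => exact: homogC
  | |- is_true ('X_ _ \is _) => exact: homogXU
  | |- is_true (- _ \is _) => apply: homogN; prove_homog
  | |- is_true (_ + _ \is _) => apply: homogD; prove_homog
  | |- is_true (_ * _ \is _) => eapply homogM; [prove_homog | prove_homog | prove_degree]
  | |- is_true (_ ^+ _ \is _) => eapply homogX; [prove_homog | prove_degree]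
  | H : _ |- is_true (_ \is _) => exact: H
  | _ => idtac
  end.

Section PencilHomogeneity.
Variables (C : comNzRingType) (n : nat) (th et : C) (N K L M : vec5 {mpoly C[n]} -> {mpoly C[n]}).
Definition doubling (Q : vec5 {mpoly C[n]} -> {mpoly C[n]}) :=
  forall d z, homog5 d z -> Q z \is (d + d).-homog.
Hypotheses (hN : doubling N) (hK : doubling K) (hL : doubling L) (hM : doubling M).
Variable y : vec4 {mpoly C[n]}.
Hypothesis hy : homog4 1 y.

Lemma polar_homog (Q : vec5 {mpoly C[n]} -> {mpoly C[n]}) d e x x' :
  (forall z, homog5 d z -> Q z \is e.-homog) ->
  homog5 d x -> homog5 d x' -> polar Q x x' \is e.-homog.
Proof.
move=> hQ hx hx'; rewrite /polar; do 2?[apply: homogD]; rewrite ?dhomogN; apply: hQ => //.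
by move: hx hx' => [? ? ? ? ?] [? ? ? ? ?]; split=> /=; rewrite mul0r addr0 !mul1r; apply: homogD.
Qed.

Lemma base_homog : homog5 2 (base th%:MP y).
Proof. by case: hy => ? ? ? ?; split=> /=; prove_homog. Qed.

Lemma dir1_homog : homog5 2 (dir1 th%:MP y).
Proof. by case: hy => ? ? ? ?; split=> /=; prove_homog. Qed.

Lemma dir2_homog : homog5 2 (dir2 et%:MP y).
Proof. by case: hy => ? ? ? ?; split=> /=; prove_homog. Qed.

Lemma Phi_homog z : homog5 2 z -> Phi N K y z \is 5.-homog.
Proof.
by case: hy => ? ? ? ? hz; have := hN hz; have := hK hz; rewrite /Phi => ? ?; prove_homog.
Qed.

Lemma Psi_homog z : homog5 2 z -> Psi L M y z \is 5.-homog.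
Proof.
by case: hy => ? ? ? ? hz; have := hL hz; have := hM hz; rewrite /Psi => ? ?; prove_homog.
Qed.

(** [tau], [alpha] and [beta] are quadratic in values of degree 5, and multiply points of degree
    2. *)
Lemma param_homog : homog5 12 (param th%:MP et%:MP N K L M y).
Proof.
have hb := base_homog; have h1 := dir1_homog; have h2 := dir2_homog.
have := polar_homog Phi_homog hb h1; have := polar_homog Psi_homog hb h1.
have := polar_homog Phi_homog hb h2; have := polar_homog Psi_homog hb h2.
have := Phi_homog hb; have := Psi_homog hb => ? ? ? ? ? ?.
have ht : tau th%:MP et%:MP N K L M y \is 10.-homog by rewrite /tau; prove_homog.
have ha : alpha th%:MP et%:MP N K L M y \is 10.-homog by rewrite /alpha; prove_homog.
have hbe : beta th%:MP N K L M y \is 10.-homog by rewrite /beta; prove_homog.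
rewrite /param; move: (tau _ _ _ _ _ _ _) (alpha _ _ _ _ _ _ _) (beta _ _ _ _ _ _) ht ha hbe.
move=> t a b ? ? ?.
move: (base _ _) (dir1 _ _) (dir2 _ _) hb h1 h2 => ? ? ? [? ? ? ? ?] [? ? ? ? ?] [? ? ? ? ?].
by split=> /=; prove_homog.
Qed.

Lemma proj_homog z : homog5 1 z -> homog4 3 (proj th%:MP et%:MP N K z).
Proof.
move=> hz; have := hN hz; have := hK hz => ? ?.
by case: hz => ? ? ? ? ?; split=> /=; prove_homog.
Qed.
End PencilHomogeneity.

(** * Rationality from a pencil *)

(** [rational_X] over any algebraically closed field, which keeps the construction of the complex
    numbers out of the argument. *)
Definition rational_cone (C : closedFieldType) (t : C) : Prop :=
  exists (d e : nat) (F : 'I_6 -> {mpoly C[4]}) (G : 'I_4 -> {mpoly C[6]})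
         (h : {mpoly C[4]}),
    (forall i, F i \is d.-homog) /\
    (forall j, G j \is e.-homog) /\
    h != 0 /\
    (forall y : 'I_4 -> C, cone t (fun i => (F i).@[y])) /\
    (forall (y : 'I_4 -> C) (j : 'I_4),
        (G j).@[fun i => (F i).@[y]] = h.@[y] * y j) /\
    (forall p : {mpoly C[6]},
        (forall y : 'I_4 -> C, p.@[fun i => (F i).@[y]] = 0) ->
        forall x : 'I_6 -> C, cone t x -> p.@[x] = 0).

Lemma fun4_homog (C : comNzRingType) n d (y : vec4 {mpoly C[n]}) j :
  homog4 d y -> fun4 y j \is d.-homog.
Proof. by case=> ? ? ? ?; rewrite /fun4; case: j => [[|[|[|[|?]]]] ?]. Qed.

Definition map2 R S (g : R -> S) (c : R * R) := (g c.1, g c.2).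

(* Formulas available in every ring, so that the same formula can be read as a polynomial, as
   its value at a point, and as a closed term to be computed in a quadratic integer ring.
   The pair of parameters stands for a cube root of unity and the golden ratio. *)
Record natural_scalar := NaturalScalar {
  scalar :> forall R : comNzRingType, R * R -> R;
  scalar_natural : forall (R S : comNzRingType) (g : {rmorphism R -> S}) c,
    g (scalar c) = scalar (map2 g c) }.

Record natural_form := NaturalForm {
  form :> forall R : comNzRingType, R * R -> vec5 R -> R;
  form_natural : forall (R S : comNzRingType) (g : {rmorphism R -> S}) c z,
    g (form c z) = form (map2 g c) (map5 g z);
  form_quadratic : forall (R : comNzRingType) (c : R * R), quadratic (form c);
  form_doubling : forall (C : comNzRingType) n (c : C * C),
    doubling (@form {mpoly C[n]} (map2 (@mpolyC n C) c)) }.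

Record natural_coordinates := NaturalCoordinates {
  coord :> forall R : comNzRingType, R * R -> ('I_6 -> R) -> vec5 R;
  cocoord : forall R : comNzRingType, R * R -> vec5 R -> 'I_6 -> R;
  coord_natural : forall (R S : comNzRingType) (g : {rmorphism R -> S}) c x,
    map5 g (coord c x) = coord (map2 g c) (fun i => g (x i));
  cocoord_natural : forall (R S : comNzRingType) (g : {rmorphism R -> S}) c z i,
    g (cocoord c z i) = cocoord (map2 g c) (map5 g z) i;
  coord_homog : forall (C : comNzRingType) n (c : C * C) d (x : 'I_6 -> {mpoly C[n]}),
    (forall i, x i \is d.-homog) -> homog5 d (coord (map2 (@mpolyC n C) c) x);
  cocoord_homog : forall (C : comNzRingType) n (c : C * C) d (z : vec5 {mpoly C[n]}) i,
    homog5 d z -> cocoord (map2 (@mpolyC n C) c) z i \is d.-homog }.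

Section Assembly.
Variables (th et : natural_scalar) (N K L M : natural_form) (co : natural_coordinates).

Definition chart R c y := param (th R c) (et R c) (N R c) (K R c) (L R c) (M R c) y.
Definition cochart R c z := proj (th R c) (et R c) (N R c) (K R c) z.
(* Where it does not vanish, [chart] inverts [cochart]. *)
Definition nondegeneracy R c z :=
  z0 z * K R c z * tau (th R c) (et R c) (N R c) (K R c) (L R c) (M R c) (cochart c z).

Lemma map_nondegeneracy (R S : comNzRingType) (g : {rmorphism R -> S}) c z :
  g (nondegeneracy c z) = nondegeneracy (map2 g c) (map5 g z).
Proof.
rewrite /nondegeneracy !rmorphM /= form_natural.
rewrite (map_tau (scalar_natural th g c) (scalar_natural et g c) (form_natural N g c)
   (form_natural K g c) (form_natural L g c) (form_natural M g c)).
by rewrite (map4_proj (scalar_natural th g c) (scalar_natural et g c) (form_natural N g c)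
   (form_natural K g c)).
Qed.

Variables (C : closedFieldType) (c : C * C) (t kappa gamma : C).
Hypothesis line_Phi : forall y : vec4 C,
  isotropic_line (Phi (N C c) (K C c) y) (dir1 (th C c) y) (dir2 (et C c) y).
Hypothesis line_Psi : forall y : vec4 C,
  isotropic_line (Psi (L C c) (M C c) y) (dir1 (th C c) y) (dir2 (et C c) y).
Hypotheses (kappa_nz : kappa != 0) (gamma_nz : gamma != 0).
Hypothesis coordK : forall z : vec5 C, co C c (cocoord co c z) = map5 ( *%R kappa) z.
Hypothesis cocoordK : forall x : 'I_6 -> C, \sum_(i < 6) x i = 0 ->
  forall i, cocoord co c (co C c x) i = kappa * x i.
Hypothesis cocoord_sum : forall z : vec5 C, \sum_(i < 6) cocoord co c z i = 0.
Hypothesis cocoord_comb : forall x y z (z1 z2 z3 : vec5 C) i,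
  cocoord co c (comb5 x z1 y z2 z z3) i =
  x * cocoord co c z1 i + y * cocoord co c z2 i + z * cocoord co c z3 i.
Hypothesis quarticE : forall x : 'I_6 -> C, \sum_(i < 6) x i = 0 ->
  (quartic_form 6 t).@[x] =
  gamma * (N C c (co C c x) * M C c (co C c x) + K C c (co C c x) * L C c (co C c x)).

Let E z := N C c z * M C c z + K C c z * L C c z.

(** The test line of the density criterion. The factor [kappa] in [fibre] appears because [coord]
    undoes [cocoord] only up to [kappa]. *)
Variables zb zv : vec5 C.
Hypotheses (zb_on : E zb = 0) (zv_off : E zv != 0).
Hypothesis fibre : forall S, E (comb5 1 zb S zv 0 zv) = 0 ->
  nondegeneracy c (map5 ( *%R kappa) (comb5 1 zb S zv 0 zv)) != 0.

Let y4 (R : comNzRingType) (y : 'I_4 -> R) :=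
  Vec4 (y (inord 0)) (y (inord 1)) (y (inord 2)) (y (inord 3)).
Let cP n : {mpoly C[n]} * {mpoly C[n]} := map2 (@mpolyC n C) c.
Let F i : {mpoly C[4]} := cocoord co (cP 4) (chart (cP 4) (y4 (fun j => 'X_j))) i.
Let G j : {mpoly C[6]} := fun4 (cochart (cP 6) (co _ (cP 6) (fun i => 'X_i))) j.
(** The scalar of [proj_param], times [kappa ^+ 3] because [proj] is cubic. *)
Let h : {mpoly C[4]} := let y := y4 (fun j => 'X_j) in
  (kappa ^+ 3)%:MP * (K _ (cP 4) (chart (cP 4) y) *
    tau (th _ (cP 4)) (et _ (cP 4)) (N _ (cP 4)) (K _ (cP 4)) (L _ (cP 4)) (M _ (cP 4)) y * y0 y).
Let k : {mpoly C[6]} := nondegeneracy (cP 6) (co _ (cP 6) (fun i => 'X_i)).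

Let mevalcP n (x : 'I_n -> C) : map2 (meval x) (cP n) = c.
Proof. by rewrite /map2 /= !mevalC; case: c. Qed.

Let map4X (y : 'I_4 -> C) : map4 (meval y) (y4 (fun j => 'X_j)) = y4 y.
Proof. by rewrite /map4 /y4 /= !mevalXU. Qed.

Let map_chart y : map5 (meval y) (chart (cP 4) (y4 (fun j => 'X_j))) = chart c (y4 y).
Proof.
rewrite /chart (map5_param (scalar_natural th _ _) (scalar_natural et _ _)
  (form_natural N _ _) (form_natural K _ _) (form_natural L _ _) (form_natural M _ _)).
by rewrite map4X /= mevalcP.
Qed.

Let cocoordZ a (z : vec5 C) i : cocoord co c (map5 ( *%R a) z) i = a * cocoord co c z i.
Proof.
have -> : map5 ( *%R a) z = comb5 a z 0 z 0 z by rewrite /comb5 /map5 !mul0r !addr0.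
by rewrite cocoord_comb !mul0r !addr0.
Qed.

Let FE y i : (F i).@[y] = cocoord co c (chart c (y4 y)) i.
Proof. by rewrite /F cocoord_natural map_chart /= mevalcP. Qed.

Let map_coord x : map5 (meval x) (co _ (cP 6) (fun i => 'X_i)) = co C c x.
Proof.
rewrite coord_natural /= mevalcP; congr (co C c _).
by apply/funext => i; rewrite mevalXU.
Qed.

Let GE x j : (G j).@[x] = fun4 (cochart c (co C c x)) j.
Proof.
have <- : map4 (meval x) (cochart (cP 6) (co _ (cP 6) (fun i => 'X_i))) = cochart c (co C c x).
  rewrite /cochart (map4_proj (scalar_natural th _ _) (scalar_natural et _ _)
    (form_natural N _ _) (form_natural K _ _)) map_coord.
  by rewrite /= mevalcP.
by rewrite /G /fun4; case: j => [[|[|[|[|?]]]] ?].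
Qed.

Let kE x : k.@[x] = nondegeneracy c (co C c x).
Proof. by rewrite /k map_nondegeneracy map_coord /= mevalcP. Qed.

Let hE y : h.@[y] = kappa ^+ 3 * (K C c (chart c (y4 y)) *
  tau (th C c) (et C c) (N C c) (K C c) (L C c) (M C c) (y4 y) * y0 (y4 y)).
Proof.
rewrite /h !rmorphM /= mevalC form_natural map_chart.
rewrite (map_tau (scalar_natural th _ _) (scalar_natural et _ _) (form_natural N _ _)
   (form_natural K _ _) (form_natural L _ _) (form_natural M _ _)) map4X /= mevalcP.
by rewrite mevalXU.
Qed.

Let quad Q := @form_quadratic Q C c.

Let F_cone y : cone t (fun i => (F i).@[y]).
Proof.
have -> : (fun i => (F i).@[y]) = cocoord co c (chart c (y4 y)).
  by apply/funext => i; rewrite FE.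
apply/coneE; split; first exact: cocoord_sum.
rewrite quarticE ?cocoord_sum // coordK !quadraticZ; try exact: quad.
set z := chart _ _.
transitivity (gamma * (kappa ^+ 4 * (N C c z * M C c z + K C c z * L C c z))); first by ring.
by rewrite /z /chart param_on ?mulr0 //; exact: quad.
Qed.

Let GF y j : (G j).@[fun i => (F i).@[y]] = h.@[y] * y j.
Proof.
rewrite GE hE.
have -> : (fun i => (F i).@[y]) = cocoord co c (chart c (y4 y)).
  by apply/funext => i; rewrite FE.
rewrite coordK /cochart projZ; try exact: quad.
rewrite /chart proj_param //; try exact: quad.
rewrite /fun4 /map4; case: j => [[|[|[|[|?]]]] ltj] //=; rewrite !mulrA; congr (_ * y _);
  by apply/val_inj; rewrite /= inordK.
Qed.

Let F_onto x : cone t x -> k.@[x] != 0 -> exists y a, a != 0 /\ forall i, (F i).@[y] = a * x i.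
Proof.
move=> /coneE[x0 xq]; rewrite kE /nondegeneracy.
set z := co C c x; set w := cochart c z => nz.
have /andP[/andP[z_nz K_nz] t_nz] : (z0 z != 0) && (K C c z != 0) &&
    (tau (th C c) (et C c) (N C c) (K C c) (L C c) (M C c) w != 0).
  by move: nz; rewrite !mulf_eq0 !negb_or.
have wE : y4 (fun4 w) = w by rewrite /y4 /fun4 !inordK //; case: (w).
pose a := K C c z ^+ 2 * z0 z * tau (th C c) (et C c) (N C c) (K C c) (L C c) (M C c) w.
exists (fun4 w), (a * kappa); split=> [|i].
  by rewrite !mulf_neq0 ?expf_neq0.
have zX : N C c z * M C c z + K C c z * L C c z = 0.
  by move/eqP: xq; rewrite quarticE // mulf_eq0 (negPf gamma_nz) => /eqP.
rewrite FE wE /chart /w /cochart param_proj //; try exact: quad.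
by rewrite cocoordZ cocoordK // mulrA.
Qed.

Let F_homog i : F i \is 12.-homog.
Proof.
(* Naturality turns the scalars into constant polynomials, the form that [param_homog] expects. *)
apply: cocoord_homog; rewrite /chart -!scalar_natural.
apply: param_homog; try exact: form_doubling.
by split; apply: homogXU.
Qed.

Let G_homog j : G j \is 3.-homog.
Proof.
apply: fun4_homog; rewrite /cochart -!scalar_natural.
apply: proj_homog; try exact: form_doubling.
by apply: coord_homog => i; apply: homogXU.
Qed.

Let EZ a z : E (map5 ( *%R a) z) = a ^+ 4 * E z.
Proof. by rewrite /E !quadraticZ; try exact: quad; ring. Qed.

Let quartic_cocoord z : (quartic_form 6 t).@[cocoord co c z] = gamma * (kappa ^+ 4 * E z).
Proof. by rewrite quarticE // coordK -/(E _) EZ. Qed.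

Let b := cocoord co c zb.
Let v := cocoord co c zv.

Let fibreE S i : b i + S * v i = cocoord co c (comb5 1 zb S zv 0 zv) i.
Proof. by rewrite cocoord_comb !mul1r mul0r addr0. Qed.

Let fibre_k S : (quartic_form 6 t).@[fun i => b i + S * v i] = 0 ->
  k.@[fun i => b i + S * v i] != 0.
Proof.
rewrite !(meval_eq _ (fibreE S)) quartic_cocoord => /eqP.
rewrite 2!mulf_eq0 expf_eq0 (negPf gamma_nz) (negPf kappa_nz) => /eqP ES.
by rewrite kE coordK; exact: fibre.
Qed.

(** Up to a nonzero scalar, [b] is in the image. Were [h] zero, [G] would vanish there, but its
    first component [K * z0] is a factor of [k], which is nonzero at [b]. *)
Let h_nz : h != 0.
Proof.
have b_on : (quartic_form 6 t).@[b] = 0 by rewrite quartic_cocoord zb_on !mulr0.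
have b_cone : cone t b by apply/coneE; split; [exact: cocoord_sum | exact: b_on].
have E0 i : b i = b i + 0 * v i by rewrite mul0r addr0.
have kb : k.@[b] != 0.
  by rewrite (meval_eq _ E0); apply: fibre_k; rewrite -(meval_eq _ E0).
have [y [a [a_nz Fy]]] := F_onto b_cone kb.
apply: contra_neq kb => h0; have := GF y ord0.
rewrite (meval_eq _ Fy) (meval_dhomog _ _ (G_homog ord0)) h0 meval0 mul0r.
move/eqP; rewrite mulf_eq0 expf_eq0 (negPf a_nz) GE /= kE => /eqP.
by rewrite /fun4 /nondegeneracy /= [z0 _ * _]mulrC => ->; rewrite mul0r.
Qed.

Lemma rational_of_pencil : rational_cone t.
Proof.
exists 12, 3, F, G, h; do ![split=> //] => p pF x xX.
apply: (@vanishing_on_image C t 12 F k _ _ _ b v) xX => //; try exact: cocoord_sum.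
by rewrite quartic_cocoord !mulf_neq0 ?expf_neq0.
Qed.
End Assembly.

(** * Quadratic integer rings *)

(* [quad a b] is Z[x] / (x^2 - a x - b), the pair (m, n) standing for m + n x. *)
Definition quad (a b : Z) : Type := (Z * Z)%type.

Lemma pairZ_eq (m n m' n' : Z) : m = m' -> n = n' -> (m, n) = (m', n') :> Z * Z.
Proof. by move=> -> ->. Qed.

Section QuadRing.
Variables a b : Z.
HB.instance Definition _ := GRing.Zmodule.on (quad a b).

Definition quad_one : quad a b := (1, 0).
Definition quad_mul (x y : quad a b) : quad a b :=
  (x.1 * y.1 + b * x.2 * y.2, x.1 * y.2 + x.2 * y.1 + a * x.2 * y.2).

Let quad_mulA : associative quad_mul.
Proof. by move=> [? ?] [? ?] [? ?]; rewrite /quad_mul /=; apply: pairZ_eq; ring. Qed.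
Let quad_mulC : commutative quad_mul.
Proof. by move=> [? ?] [? ?]; rewrite /quad_mul /=; apply: pairZ_eq; ring. Qed.
Let quad_mul1 : left_id quad_one quad_mul.
Proof. by move=> [? ?]; rewrite /quad_mul /=; apply: pairZ_eq; ring. Qed.
Let quad_mulDl : left_distributive quad_mul +%R.
Proof. by move=> [? ?] [? ?] [? ?]; rewrite /quad_mul /=; apply: pairZ_eq => /=; ring. Qed.

HB.instance Definition _ := GRing.Zmodule_isComNzRing.Build (quad a b)
  quad_mulA quad_mulC quad_mul1 quad_mulDl (isT : quad_one != 0).

Variables (C : numDomainType) (x : C).

(** The proof [root_x] is an argument so that the morphism structures can be attached to
    [quad_val root_x]. *)
Definition quad_val (root_x : x * x = (int_of_Z a)%:~R * x + (int_of_Z b)%:~R) (q : quad a b) : C :=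
  (int_of_Z q.1)%:~R + (int_of_Z q.2)%:~R * x.

Hypothesis root_x : x * x = (int_of_Z a)%:~R * x + (int_of_Z b)%:~R.

Let quad_val_additive : zmod_morphism (quad_val root_x).
Proof. by move=> [? ?] [? ?]; rewrite /quad_val /= !rmorphB /=; ring. Qed.

Let quad_val_multiplicative : monoid_morphism (quad_val root_x).
Proof.
split=> [|[m n] [m' n']]; rewrite /quad_val /=; first by rewrite mul0r addr0.
rewrite !(rmorphD, rmorphM) /=; ring: root_x.
Qed.

HB.instance Definition _ :=
  GRing.isZmodMorphism.Build (quad a b) C (quad_val root_x) quad_val_additive.
HB.instance Definition _ :=
  GRing.isMonoidMorphism.Build (quad a b) C (quad_val root_x) quad_val_multiplicative.

Lemma quad_val_pair m n :
  quad_val root_x (m, n) = (int_of_Z m)%:~R + (int_of_Z n)%:~R * x.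
Proof. by []. Qed.

Definition quad_norm (q : quad a b) : Z := q.1 * q.1 + a * q.1 * q.2 - b * q.2 * q.2.

(** Multiplying by the conjugate, with [a - x] in place of [x], gives the integer norm, and the
    characteristic is zero. *)
Lemma quad_val_neq0 q : quad_norm q != 0 -> quad_val root_x q != 0.
Proof.
case: q => m n; apply: contra_neq => q0.
have : (int_of_Z (quad_norm (m, n)))%:~R =
    quad_val root_x (m, n) * ((int_of_Z m)%:~R + (int_of_Z n)%:~R * ((int_of_Z a)%:~R - x)).
  by rewrite /quad_val /quad_norm /= !(rmorphD, rmorphN, rmorphM) /=; ring: root_x.
rewrite q0 mul0r => /eqP; rewrite intr_eq0 => /eqP/(congr1 Z_of_int).
by rewrite int_of_ZK.
Qed.
End QuadRing.

(** * Eigencoordinates of two 3-cycles *)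

(* (s, u, v, u', v'): the sum of x_0, x_1, x_2 and the eigencoordinates of the two
   3-cycles (0 1 2) and (3 4 5), w being a primitive cube root of unity. *)
Record eigen5 (R : Type) := Eigen5 { es : R; eu : R; ev : R; eu' : R; ev' : R }.

Section Eigen.
Variable R : comNzRingType.

Definition eigen (w : R) (x : 'I_6 -> R) := let X i := x (inord i) in Eigen5
  (X 0 + X 1 + X 2)
  (X 0 + w * X 1 + w ^+ 2 * X 2) (X 0 + w ^+ 2 * X 1 + w * X 2)
  (X 3 + w * X 4 + w ^+ 2 * X 5) (X 3 + w ^+ 2 * X 4 + w * X 5).

(** Inverse discrete Fourier transform on each triple, up to the factor 3; on the hyperplane the
    second triple has sum [- es e]. *)
Definition uneigen (w : R) (e : eigen5 R) (i : 'I_6) : R := nth 0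
  [:: es e + eu e + ev e;
      es e + w ^+ 2 * eu e + w * ev e;
      es e + w * eu e + w ^+ 2 * ev e;
      - es e + eu' e + ev' e;
      - es e + w ^+ 2 * eu' e + w * ev' e;
      - es e + w * eu' e + w ^+ 2 * ev' e] i.

Lemma sum6 (x : 'I_6 -> R) : \sum_(i < 6) x i =
  x (inord 0) + x (inord 1) + x (inord 2) + x (inord 3) + x (inord 4) + x (inord 5).
Proof.
rewrite !big_ord_recl big_ord0 addr0 !addrA.
by do !congr (_ + _); congr x; apply/val_inj; rewrite /= inordK.
Qed.

Variable w : R.
Hypothesis w2 : w ^+ 2 = - w - 1.

Lemma uneigen_sum e : \sum_(i < 6) uneigen w e i = 0.
Proof. by rewrite sum6 /uneigen !inordK //= w2; ring. Qed.

Lemma eigenK e : let: Eigen5 s u v u' v' := e in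
  eigen w (uneigen w e) = Eigen5 (3%:R * s) (3%:R * u) (3%:R * v) (3%:R * u') (3%:R * v').
Proof.
have w2' : w * w = - w - 1 by rewrite -expr2.
case: e => s u v u' v'; rewrite /eigen /uneigen !inordK //= w2.
by congr Eigen5; ring: w2'.
Qed.

Lemma uneigenK x : \sum_(i < 6) x i = 0 -> forall i, uneigen w (eigen w x) i = 3%:R * x i.
Proof.
have w2' : w * w = - w - 1 by rewrite -expr2.
rewrite sum6 => x0 i; have -> : x i = x (inord i) by rewrite inord_val.
have x5 : x (inord 5) = - (x (inord 0) + x (inord 1) + x (inord 2) + x (inord 3) + x (inord 4)).
  by apply/eqP; rewrite -addr_eq0 addrC x0.
by case: i => [[|[|[|[|[|[|?]]]]]] ?] //; rewrite /uneigen /eigen /= ?x5 w2; ring: w2'.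
Qed.

Lemma triple_power_sums a b c :
  let s := a + b + c in let u := a + w * b + w ^+ 2 * c in let v := a + w ^+ 2 * b + w * c in
  (3%:R * (a ^+ 2 + b ^+ 2 + c ^+ 2) = s ^+ 2 + 2%:R * (u * v)) *
  (27%:R * (a ^+ 4 + b ^+ 4 + c ^+ 4) =
     s ^+ 4 + 12%:R * s ^+ 2 * (u * v) + 4%:R * s * (u ^+ 3 + v ^+ 3) + 6%:R * (u * v) ^+ 2).
Proof.
move=> s u v.
have w2' : w * w = - w - 1 by rewrite -expr2.
(* Once [u * v] and [u + v] are written without [w], the claims are plain identities in [a], [b],
   [c]. *)
have uv : u * v = (a - c) * (a - b) + (b - c) ^+ 2 by rewrite /u /v w2; ring: w2'.
have u3v3 : u ^+ 3 + v ^+ 3 = (u + v) ^+ 3 - 3%:R * (u * v) * (u + v) by ring.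
have uDv : u + v = 2%:R * a - b - c by rewrite /u /v w2; ring.
by rewrite u3v3 uDv uv /s; split; ring.
Qed.

(** The power sums of the two triples are added; the second has sum [- s], whence the signs of its
    cubes. *)
Lemma quartic_eigen t x : \sum_(i < 6) x i = 0 ->
  27%:R * (quartic_form 6 t).@[x] =
  let: Eigen5 s u v u' v' := eigen w x in let p := u * v in let q := u' * v' in
  2%:R * s ^+ 4 + 12%:R * s ^+ 2 * (p + q) + 4%:R * s * (u ^+ 3 + v ^+ 3 - u' ^+ 3 - v' ^+ 3)
  + 6%:R * (p ^+ 2 + q ^+ 2) - 12%:R * t * (s ^+ 2 + p + q) ^+ 2.
Proof.
rewrite sum6 quartic_formE !sum6 /eigen.
move: (x (inord 0)) (x (inord 1)) (x (inord 2)) (x (inord 3)) (x (inord 4)) (x (inord 5)).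
move=> a b c a' b' c' sum0.
have s' : a' + b' + c' = - (a + b + c) by apply/eqP; rewrite -addr_eq0 addrC !addrA sum0.
have [p2 p4] := triple_power_sums a b c; have := triple_power_sums a' b' c'.
rewrite s' => -[p2' p4'].
transitivity (27%:R * (a ^+ 4 + b ^+ 4 + c ^+ 4) + 27%:R * (a' ^+ 4 + b' ^+ 4 + c' ^+ 4)
  - 3%:R * t * (3%:R * (a ^+ 2 + b ^+ 2 + c ^+ 2) + 3%:R * (a' ^+ 2 + b' ^+ 2 + c' ^+ 2)) ^+ 2).
  by ring.
by rewrite p2 p4 p2' p4'; ring.
Qed.
End Eigen.

Definition eigen_map R S (g : R -> S) e :=
  Eigen5 (g (es e)) (g (eu e)) (g (ev e)) (g (eu' e)) (g (ev' e)).

Lemma map_eigen (R S : comNzRingType) (g : {rmorphism R -> S}) w x :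
  eigen_map g (eigen w x) = eigen (g w) (fun i => g (x i)).
Proof. by rewrite /eigen_map /eigen /= !(rmorphD, rmorphM, rmorphXn). Qed.

Lemma map_uneigen (R S : comNzRingType) (g : {rmorphism R -> S}) w e i :
  g (uneigen w e i) = uneigen (g w) (eigen_map g e) i.
Proof.
case: i => [[|[|[|[|[|[|?]]]]]] ?] //; rewrite /uneigen /=;
  by rewrite !(rmorphD, rmorphN, rmorphM, rmorphXn).
Qed.

(** * The case t = 1/6 *)

Ltac prove_natural := intros; rewrite /map2 /map5 /=;
  rewrite !(rmorphD, rmorphN, rmorphM, rmorphXn, rmorph_nat, rmorph0, rmorph1).

Section SixthForms.
Variables (R : comNzRingType) (c : R * R).
Let w := c.1.
(** Coordinates adapted to the lines, with [th = w] and [et = 0]: the lines sweep out a quadric cone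
    in [z0 = 0], with vertex [dir2]. *)
Definition sixth_eigen (z : vec5 R) :=
  Eigen5 (z2 z) (f1 z + w * f2 z) (z0 z - w ^+ 2 * z1 z) (f2 z) (z1 z).
Definition sixth_coord_of (e : eigen5 R) : vec5 R :=
  Vec5 (ev e + w ^+ 2 * ev' e) (ev' e) (es e) (eu e - w * eu' e) (eu' e).
(** Exchanging [(u, u')] with [(v, v')] swaps [N] and [M] and fixes [K] and [L]. *)
Definition sixthN z := let: Eigen5 s u v u' v' := sixth_eigen z in
  v ^+ 2 + v * v' + v' ^+ 2 + s * (u - u').
Definition sixthK z := let: Eigen5 s u v u' v' := sixth_eigen z in (u + u') * (v + v').
Definition sixthL z := let: Eigen5 s u v u' v' := sixth_eigen z in s ^+ 2 - u * v' - u' * v.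
Definition sixthM z := let: Eigen5 s u v u' v' := sixth_eigen z in
  u ^+ 2 + u * u' + u' ^+ 2 + s * (v - v').
End SixthForms.

Program Definition sixth_N := @NaturalForm sixthN _ _ _.
Next Obligation. by rewrite /sixthN; prove_natural. Qed.
Next Obligation. by move=> *; rewrite /polar /sixthN /=; ring. Qed.
Next Obligation. by move=> d z [? ? ? ? ?]; rewrite /sixthN /=; prove_homog. Qed.

Program Definition sixth_K := @NaturalForm sixthK _ _ _.
Next Obligation. by rewrite /sixthK; prove_natural. Qed.
Next Obligation. by move=> *; rewrite /polar /sixthK /=; ring. Qed.
Next Obligation. by move=> d z [? ? ? ? ?]; rewrite /sixthK /=; prove_homog. Qed.

Program Definition sixth_L := @NaturalForm sixthL _ _ _.
Next Obligation. by rewrite /sixthL; prove_natural. Qed.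
Next Obligation. by move=> *; rewrite /polar /sixthL /=; ring. Qed.
Next Obligation. by move=> d z [? ? ? ? ?]; rewrite /sixthL /=; prove_homog. Qed.

Program Definition sixth_M := @NaturalForm sixthM _ _ _.
Next Obligation. by rewrite /sixthM; prove_natural. Qed.
Next Obligation. by move=> *; rewrite /polar /sixthM /=; ring. Qed.
Next Obligation. by move=> d z [? ? ? ? ?]; rewrite /sixthM /=; prove_homog. Qed.

Program Definition sixth_th := @NaturalScalar (fun R c => c.1) _.
Program Definition zero_scalar := @NaturalScalar (fun R c => 0) _.
Next Obligation. exact: rmorph0. Qed.
Program Definition one_scalar := @NaturalScalar (fun R c => 1) _.
Next Obligation. exact: rmorph1. Qed.

Lemma uneigen_homog (C : comNzRingType) n w d (e : eigen5 {mpoly C[n]}) i :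
  [/\ es e \is d.-homog, eu e \is d.-homog, ev e \is d.-homog,
      eu' e \is d.-homog & ev' e \is d.-homog] -> uneigen w%:MP e i \is d.-homog.
Proof.
by case=> ? ? ? ? ?; case: i => [[|[|[|[|[|[|?]]]]]] ?] //; rewrite /uneigen /=; prove_homog.
Qed.

Lemma sixth_coord_natural (R S : comNzRingType) (g : {rmorphism R -> S}) c x :
  map5 g (sixth_coord_of c (eigen c.1 x)) =
  sixth_coord_of (map2 g c) (eigen (map2 g c).1 (fun i => g (x i))).
Proof. by rewrite /= -map_eigen /sixth_coord_of; prove_natural. Qed.

Lemma sixth_cocoord_natural (R S : comNzRingType) (g : {rmorphism R -> S}) c z i :
  g (uneigen c.1 (sixth_eigen c z) i) =
  uneigen (map2 g c).1 (sixth_eigen (map2 g c) (map5 g z)) i.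
Proof. by rewrite map_uneigen /sixth_eigen /eigen_map /=; prove_natural. Qed.

Lemma sixth_coord_homog (C : comNzRingType) n (c : C * C) d (x : 'I_6 -> {mpoly C[n]}) :
  (forall i, x i \is d.-homog) ->
  let c' := map2 (@mpolyC n C) c in homog5 d (sixth_coord_of c' (eigen c'.1 x)).
Proof. by move=> hx c'; split=> /=; prove_homog. Qed.

Lemma sixth_cocoord_homog (C : comNzRingType) n (c : C * C) d (z : vec5 {mpoly C[n]}) i :
  homog5 d z -> let c' := map2 (@mpolyC n C) c in uneigen c'.1 (sixth_eigen c' z) i \is d.-homog.
Proof. by case=> ? ? ? ? ?; apply: uneigen_homog; split=> /=; prove_homog. Qed.

Definition sixth_co := NaturalCoordinates
  sixth_coord_natural sixth_cocoord_natural sixth_coord_homog sixth_cocoord_homog.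

Definition sixth_nondeg R c z :=
  @nondegeneracy sixth_th zero_scalar sixth_N sixth_K sixth_L sixth_M R c z.

Section Sixth.
Variables (C : numClosedFieldType) (w : C).
Hypothesis w2 : w ^+ 2 = - w - 1.
Let c : C * C := (w, 0).

(* The line [zb + S zv] was found by searching for four collinear rational points. *)
Let zb : vec5 C := Vec5 (- w ^+ 2) (-1) 1 (-1) 0.
Let zv : vec5 C := Vec5 (-1 + w ^+ 2) 1 1 (-1 - w) 1.
Let w2' : w * w = - w - 1. Proof. by rewrite -expr2. Qed.

Let quartic_sixth (x : 'I_6 -> C) : \sum_(i < 6) x i = 0 ->
  let z := sixth_coord_of c (eigen w x) in
  (quartic_form 6 (1 / 6%:R)).@[x] =
    4%:R / 27%:R * (sixthN c z * sixthM c z + sixthK c z * sixthL c z).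
Proof.
move=> x0 z; have := quartic_eigen w2 (1 / 6%:R) x0.
have zE : sixth_eigen c z = eigen w x.
  by rewrite /z; case: (eigen w x) => *; rewrite /sixth_eigen /=; congr Eigen5; ring.
rewrite /sixthN /sixthM /sixthK /sixthL zE; case: (eigen w x) => s u v u' v' E.
apply: (mulfI (_ : 27%:R != 0)); first by rewrite pnatr_eq0.
by rewrite E; field.
Qed.

Lemma rational_sixth : rational_cone (1 / 6%:R : C).
Proof.
have nz (n : nat) : n.+1%:R != 0 :> C by rewrite pnatr_eq0.
apply: (@rational_of_pencil sixth_th zero_scalar sixth_N sixth_K sixth_L sixth_M sixth_co
  C c _ 3%:R (4%:R / 27%:R) _ _ _ _ _ _ _ _ _ zb zv).
- by move=> y; split; rewrite /Phi /polar /= /sixthN /sixthK /=; ring: w2'.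
- by move=> y; split; rewrite /Psi /polar /= /sixthL /sixthM /=; ring: w2'.
- exact: nz.
- by rewrite mulf_neq0 ?invr_eq0.
- move=> z /=; have := eigenK w2 (sixth_eigen c z).
  rewrite /= => ->; rewrite /sixth_coord_of /map5 /=; congr Vec5; ring.
- move=> x x0 i /=; rewrite -(uneigenK w2 x0).
  congr (uneigen _ _ _); case: (eigen w x) => *; rewrite /sixth_eigen /=; congr Eigen5; ring.
- by move=> z; apply: uneigen_sum.
- move=> a b e z1 z2 z3 i /=.
  by case: i => [[|[|[|[|[|[|?]]]]]] ?] //; rewrite /uneigen /sixth_eigen /=; ring.
- exact: quartic_sixth.
- by rewrite /c /zb /zv /= /sixthN /sixthM /sixthK /sixthL /=; ring: w2'.
- rewrite (_ : _ + _ = 1) ?oner_neq0 //.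
  by rewrite /c /zb /zv /= /sixthN /sixthM /sixthK /sixthL /=; ring: w2'.
move=> S ES.
(* On the test line the quartic is exactly the product of these four factors. *)
have {ES} : [|| S == 0, S - 1 == 0, S + 2%:R == 0 | S + 3%:R == 0].
  rewrite !orbA -!mulf_eq0; apply/eqP.
  by rewrite -ES /c /zb /zv /= /sixthN /sixthM /sixthK /sixthL /=; ring: w2'.
have root_w : w * w = (int_of_Z (-1))%:~R * w + (int_of_Z (-1))%:~R.
  by rewrite w2' /= NegzE; ring.
pose Q := quad (-1) (-1).
(* The four points have coordinates in the integer ring generated by [w], so nonvanishing is decided
   by computing a norm there. *)
have good (z : vec5 Q) : quad_norm (sixth_nondeg ((0, 1) : Q, 0 : Q) z) != 0 ->
    sixth_nondeg c (map5 (quad_val root_w) z) != 0.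
  move=> nz_z; have -> : c = map2 (quad_val root_w) ((0, 1) : Q, 0 : Q).
    by rewrite /map2 /= rmorph0 /quad_val /= !rmorph0 !rmorph1 add0r mul1r.
  by rewrite /sixth_nondeg -map_nondegeneracy quad_val_neq0.
have numE := (rmorph0, rmorph1, rmorphN, rmorph_nat).
case/or4P=> /eqP.
- move=> ->.
  have -> : map5 ( *%R 3%:R) (comb5 1 zb 0 zv 0 zv) =
      map5 (quad_val root_w) (Vec5 (3, 3) (-3, 0) (3, 0) (-3, 0) (0, 0)).
    by rewrite [RHS]map5E !quad_val_pair !numE /map5 /zb /zv /=; congr Vec5; ring: w2'.
  by apply: good; vm_compute.
- move/subr0_eq=> ->.
  have -> : map5 ( *%R 3%:R) (comb5 1 zb 1 zv 0 zv) =
      map5 (quad_val root_w) (Vec5 (-3, 0) (0, 0) (6, 0) (-6, -3) (3, 0)).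
    by rewrite [RHS]map5E !quad_val_pair !numE /map5 /zb /zv /=; congr Vec5; ring: w2'.
  by apply: good; vm_compute.
- move/eqP; rewrite addr_eq0 => /eqP ->.
  have -> : map5 ( *%R 3%:R) (comb5 1 zb (- 2%:R) zv 0 zv) =
      map5 (quad_val root_w) (Vec5 (15, 9) (-9, 0) (-3, 0) (3, 6) (-6, 0)).
    by rewrite [RHS]map5E !quad_val_pair !numE /map5 /zb /zv /=; congr Vec5; ring: w2'.
  by apply: good; vm_compute.
- move/eqP; rewrite addr_eq0 => /eqP ->.
  have -> : map5 ( *%R 3%:R) (comb5 1 zb (- 3%:R) zv 0 zv) =
      map5 (quad_val root_w) (Vec5 (21, 12) (-12, 0) (-6, 0) (6, 9) (-9, 0)).
    by rewrite [RHS]map5E !quad_val_pair !numE /map5 /zb /zv /=; congr Vec5; ring: w2'.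
  by apply: good; vm_compute.
Qed.
End Sixth.

(** * The case t = 7/10 *)

Section TenthsForms.
Variables (R : comNzRingType) (c : R * R).
Let g := c.2.
Let r := 4%:R - 3%:R * g.
Let r' := 1 + 3%:R * g.
(** For [g] the golden ratio [r * r' = -5], which explains the factors 5 in [tenths_coord_of]. The
    scaling brings the ruling to [dir1], [dir2] with [th = 0] and [et = 1]. *)
Definition tenths_eigen (z : vec5 R) := Eigen5 (z0 z) (z1 z) (r * f2 z) (z2 z) (r' * f1 z).
Definition tenths_coord_of (e : eigen5 R) : vec5 R :=
  Vec5 (- (5%:R * es e)) (- (5%:R * eu e)) (- (5%:R * eu' e)) (r * ev' e) (r' * ev e).
Definition tenthsN z := let: Eigen5 s u v u' v' := tenths_eigen z in
  4%:R * s ^+ 2 - u * v - u' * v' + r' * u * v' + r * u' * v.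
Definition tenthsM z := let: Eigen5 s u v u' v' := tenths_eigen z in
  4%:R * s ^+ 2 - u * v - u' * v' + r * u * v' + r' * u' * v.
Definition tenthsK z := let: Eigen5 s u v u' v' := tenths_eigen z in
  v ^+ 2 + v * v' + v' ^+ 2 - 2%:R * s * (u - u').
Definition tenthsL z := let: Eigen5 s u v u' v' := tenths_eigen z in
  5%:R * (u ^+ 2 + u * u' + u' ^+ 2 - 2%:R * s * (v - v')).
End TenthsForms.

Program Definition tenths_N := @NaturalForm tenthsN _ _ _.
Next Obligation. by rewrite /tenthsN; prove_natural. Qed.
Next Obligation. by move=> *; rewrite /polar /tenthsN /=; ring. Qed.
Next Obligation. by move=> d z [? ? ? ? ?]; rewrite /tenthsN /=; prove_homog. Qed.

Program Definition tenths_K := @NaturalForm tenthsK _ _ _.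
Next Obligation. by rewrite /tenthsK; prove_natural. Qed.
Next Obligation. by move=> *; rewrite /polar /tenthsK /=; ring. Qed.
Next Obligation. by move=> d z [? ? ? ? ?]; rewrite /tenthsK /=; prove_homog. Qed.

Program Definition tenths_L := @NaturalForm tenthsL _ _ _.
Next Obligation. by rewrite /tenthsL; prove_natural. Qed.
Next Obligation. by move=> *; rewrite /polar /tenthsL /=; ring. Qed.
Next Obligation. by move=> d z [? ? ? ? ?]; rewrite /tenthsL /=; prove_homog. Qed.

Program Definition tenths_M := @NaturalForm tenthsM _ _ _.
Next Obligation. by rewrite /tenthsM; prove_natural. Qed.
Next Obligation. by move=> *; rewrite /polar /tenthsM /=; ring. Qed.
Next Obligation. by move=> d z [? ? ? ? ?]; rewrite /tenthsM /=; prove_homog. Qed.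

Lemma tenths_coord_natural (R S : comNzRingType) (g : {rmorphism R -> S}) c x :
  map5 g (tenths_coord_of c (eigen c.1 x)) =
  tenths_coord_of (map2 g c) (eigen (map2 g c).1 (fun i => g (x i))).
Proof. by rewrite /= -map_eigen /tenths_coord_of; prove_natural. Qed.

Lemma tenths_cocoord_natural (R S : comNzRingType) (g : {rmorphism R -> S}) c z i :
  g (uneigen c.1 (tenths_eigen c z) i) =
  uneigen (map2 g c).1 (tenths_eigen (map2 g c) (map5 g z)) i.
Proof. by rewrite map_uneigen /tenths_eigen /eigen_map /=; prove_natural. Qed.

Lemma tenths_coord_homog (C : comNzRingType) n (c : C * C) d (x : 'I_6 -> {mpoly C[n]}) :
  (forall i, x i \is d.-homog) ->
  let c' := map2 (@mpolyC n C) c in homog5 d (tenths_coord_of c' (eigen c'.1 x)).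
Proof. by move=> hx c'; split=> /=; prove_homog. Qed.

Lemma tenths_cocoord_homog (C : comNzRingType) n (c : C * C) d (z : vec5 {mpoly C[n]}) i :
  homog5 d z -> let c' := map2 (@mpolyC n C) c in uneigen c'.1 (tenths_eigen c' z) i \is d.-homog.
Proof. by case=> ? ? ? ? ?; apply: uneigen_homog; split=> /=; prove_homog. Qed.

Definition tenths_co := NaturalCoordinates
  tenths_coord_natural tenths_cocoord_natural tenths_coord_homog tenths_cocoord_homog.

Definition tenths_nondeg R c z :=
  @nondegeneracy zero_scalar one_scalar tenths_N tenths_K tenths_L tenths_M R c z.

Section Tenths.
Variables (C : numClosedFieldType) (w g : C).
Hypotheses (w2 : w ^+ 2 = - w - 1) (g2 : g * g = g + 1).
Let c : C * C := (w, g).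

(* Found, like the line above, by a search for four collinear points, here over Q(sqrt 5). *)
Let zb : vec5 C := Vec5 (- 20%:R) (10%:R - 20%:R * g) (20%:R - 5%:R * g)
  (14%:R - 8%:R * g) (1%:R - 2%:R * g).
Let zv : vec5 C := Vec5 (25%:R - 5%:R * g) (- 25%:R + 25%:R * g) (- 30%:R + 5%:R * g)
  (- 27%:R + 14%:R * g) (- 13%:R - 14%:R * g).

Let tenths_coordK (e : eigen5 C) : let: Eigen5 s u v u' v' := e in
  tenths_eigen c (tenths_coord_of c e) =
  Eigen5 (- (5%:R * s)) (- (5%:R * u)) (- (5%:R * v)) (- (5%:R * u')) (- (5%:R * v')).
Proof. by case: e => s u v u' v'; rewrite /tenths_eigen /c /=; congr Eigen5; ring: g2. Qed.

Let quartic_tenths (x : 'I_6 -> C) : \sum_(i < 6) x i = 0 ->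
  let z := tenths_coord_of c (eigen w x) in
  (quartic_form 6 (7%:R / 10%:R)).@[x] =
    - (2%:R / (135%:R * 625%:R)) * (tenthsN c z * tenthsM c z + tenthsK c z * tenthsL c z).
Proof.
move=> x0 z; have := quartic_eigen w2 (7%:R / 10%:R) x0.
rewrite {}/z; move: (eigen w x) => e; have := tenths_coordK e.
rewrite /tenthsN /tenthsM /tenthsK /tenthsL; case: e => s u v u' v' -> E.
apply: (mulfI (_ : 27%:R != 0)); first by rewrite pnatr_eq0.
rewrite E /=.
(* [N] and [M] are conjugate under [g -> 1 - g], which swaps [r] and [r'], so [g] cancels from their
   product. *)
have NM a p q :
    (a + (1 + 3%:R * g) * p + (4%:R - 3%:R * g) * q) *
    (a + (4%:R - 3%:R * g) * p + (1 + 3%:R * g) * q)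
    = a ^+ 2 + 5%:R * a * (p + q) - 5%:R * (p ^+ 2 + q ^+ 2) + 35%:R * p * q by ring: g2.
rewrite -![_ * - (5%:R * u) * _]mulrA -![_ * - (5%:R * u') * _]mulrA NM.
by field.
Qed.

Lemma rational_tenths : rational_cone (7%:R / 10%:R : C).
Proof.
have nz (n : nat) : n.+1%:R != 0 :> C by rewrite pnatr_eq0.
apply: (@rational_of_pencil zero_scalar one_scalar tenths_N tenths_K tenths_L tenths_M tenths_co
  C c _ (- 15%:R) (- (2%:R / (135%:R * 625%:R))) _ _ _ _ _ _ _ _ _ zb zv).
- by move=> y; split; rewrite /Phi /polar /c /= /tenthsN /tenthsK /=; [ring | ring | ring: g2].
- by move=> y; split; rewrite /Psi /polar /c /= /tenthsL /tenthsM /=; ring: g2.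
- by rewrite oppr_eq0.
- by rewrite oppr_eq0 mulf_neq0 ?invr_eq0 ?mulf_neq0.
- move=> z /=; have := eigenK w2 (tenths_eigen c z).
  rewrite /= => ->; rewrite /tenths_coord_of /map5 /c /=; congr Vec5; ring: g2.
- move=> x x0 i /=.
  rewrite (_ : - 15%:R * x i = - 5%:R * (3%:R * x i)); last by ring.
  rewrite -(uneigenK w2 x0); move: (eigen w x) => e; have := tenths_coordK e.
  case: e => s u v u' v' ->.
  by case: i => [[|[|[|[|[|[|?]]]]]] ?] //; rewrite /uneigen /=; ring.
- by move=> z; apply: uneigen_sum.
- move=> a b e z1 z2 z3 i /=.
  by case: i => [[|[|[|[|[|[|?]]]]]] ?] //; rewrite /uneigen /tenths_eigen /=; ring.
- exact: quartic_tenths.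
- by rewrite /c /zb /zv /= /tenthsN /tenthsM /tenthsK /tenthsL /=; ring: g2.
- rewrite (_ : _ + _ = 162%:R * 5%:R ^+ 5 * (5%:R + 8%:R * g)); last first.
    by rewrite /c /zb /zv /= /tenthsN /tenthsM /tenthsK /tenthsL /=; ring: g2.
  rewrite !mulf_neq0 ?expf_neq0 //.
  (* [5 + 8 g] is the sixth power of the golden ratio, hence a unit. *)
  have e1 : (5%:R + 8%:R * g) * (13%:R - 8%:R * g) = 1 by ring: g2.
  by apply/eqP => h0; move: (oner_neq0 C); rewrite -e1 h0 mul0r eqxx.
move=> S ES.
(* On this line the quartic is the product of the four factors, times [54 * 5 ^ 5] and the unit
   [5 + 8 g]. *)
have {ES} : [|| S == 0, S - 1 == 0, S - 2%:R == 0 | 3%:R * S - 1 == 0].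
  rewrite !orbA -!mulf_eq0.
  suff : (5%:R + 8%:R * g) * (S * (S - 1) * (S - 2%:R) * (3%:R * S - 1)) = 0.
    move/(congr1 ( *%R (13%:R - 8%:R * g))); rewrite mulr0 mulrA.
    have -> : (13%:R - 8%:R * g) * (5%:R + 8%:R * g) = 1 by ring: g2.
    by rewrite mul1r => ->.
  apply: (mulfI (_ : 54%:R * 5%:R ^+ 5 != 0)); first by rewrite mulf_neq0 ?expf_neq0.
  by rewrite mulr0 -ES /c /zb /zv /= /tenthsN /tenthsM /tenthsK /tenthsL /=; ring: g2.
have root_g : g * g = (int_of_Z 1)%:~R * g + (int_of_Z 1)%:~R.
  by rewrite g2 !rmorph1 mul1r.
pose Q := quad 1 1.
have good (z : vec5 Q) : quad_norm (tenths_nondeg (0 : Q, (0, 1) : Q) z) != 0 ->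
    tenths_nondeg c (map5 (quad_val root_g) z) != 0.
  move=> nz_z.
  have := quad_val_neq0 root_g nz_z; rewrite /tenths_nondeg map_nondegeneracy.
  (* These forms do not involve the cube root of unity, so 0 may stand for it. *)
  rewrite (_ : map2 _ _ = (0, g)) // /map2 /= rmorph0 quad_val_pair.
  by rewrite !rmorph0 !rmorph1 add0r mul1r.
have numE := (rmorph0, rmorph1, rmorphN, rmorph_nat).
case/or4P=> /eqP.
- move=> ->.
  have -> : map5 ( *%R (- 15%:R)) (comb5 1 zb (0) zv 0 zv) =
      map5 (quad_val root_g) (Vec5 (300, 0) (-150, 300) (-300, 75) (-210, 120) (-15, 30)).
    by rewrite [RHS]map5E !quad_val_pair !numE /map5 /zb /zv /=; congr Vec5; ring.
  by apply: good; vm_compute.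
- move/subr0_eq=> ->.
  have -> : map5 ( *%R (- 15%:R)) (comb5 1 zb (1) zv 0 zv) =
      map5 (quad_val root_g) (Vec5 (-75, 75) (225, -75) (150, 0) (195, -90) (180, 240)).
    by rewrite [RHS]map5E !quad_val_pair !numE /map5 /zb /zv /=; congr Vec5; ring.
  by apply: good; vm_compute.
- move/subr0_eq=> ->.
  have -> : map5 ( *%R (- 15%:R)) (comb5 1 zb (2%:R) zv 0 zv) =
      map5 (quad_val root_g) (Vec5 (-450, 150) (600, -450) (600, -75) (600, -300) (375, 450)).
    by rewrite [RHS]map5E !quad_val_pair !numE /map5 /zb /zv /=; congr Vec5; ring.
  by apply: good; vm_compute.
- move/subr0_eq/(canRL (mulKf (nz 2))); rewrite mulr1 => ->.
  have -> : map5 ( *%R (- 15%:R)) (comb5 1 zb (3%:R^-1) zv 0 zv) =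
      map5 (quad_val root_g) (Vec5 (175, 25) (-25, 175) (-150, 50) (-75, 50) (50, 100)).
    by rewrite [RHS]map5E !quad_val_pair !numE /map5 /zb /zv /=; congr Vec5; field.
  by apply: good; vm_compute.
Qed.
End Tenths.

(** * Existence of the cube root of unity and the golden ratio, and conclusion *)

Lemma rational_cones (C : numClosedFieldType) :
  rational_cone (1 / 6%:R : C) /\ rational_cone (7%:R / 10%:R : C).
Proof.
have nz2 : 2%:R != 0 :> C by rewrite pnatr_eq0.
have [a aE] : exists a : C, a ^+ 2 = - 3%:R by apply: closed_root.
have [b bE] : exists b : C, b ^+ 2 = 5%:R by apply: closed_root.
have w2 : ((a - 1) / 2%:R) ^+ 2 = - ((a - 1) / 2%:R) - 1.
  rewrite (_ : ((a - 1) / 2%:R) ^+ 2 = (a ^+ 2 - 2%:R * a + 1) / 4%:R); last by field.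
  by rewrite aE; field.
have g2 : ((b + 1) / 2%:R) * ((b + 1) / 2%:R) = (b + 1) / 2%:R + 1.
  rewrite (_ : _ * _ = (b ^+ 2 + 2%:R * b + 1) / 4%:R); last by field.
  by rewrite bE; field.
by split; [exact: rational_sixth w2 | exact: rational_tenths w2 g2].
Qed.

Theorem theorem1p3 : rational_X (1 / 6) /\ rational_X (7 / 10).
Proof. exact: (rational_cones CC_numClosed). Qed.
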